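(* Let $\Lambda$ be a ring with identity and $A,B,C\in\Lambda$. Then in $\Lambda[[z]]$: (1) $M_0=1+J_0+J_0^2+\cdots$; (2) $G(w)=M_0-M_1M_0^{-1}M_{-1}$.
   Context: A walk of length $l\ge0$ is an $(l+1)$-tuple $\alpha=(\alpha_0,\dots,\alpha_l)$ of integers with each $\alpha_i-\alpha_{i-1}\in\{-1,0,1\}$; it is a walk from $\alpha_0$ to $\alpha_l$. Its weight is $w(\alpha)=1$ if $l=0$, and otherwise $w(\alpha)=U_1\cdots U_l$ with $U_i=A,B,C$ according as $\alpha_i-\alpha_{i-1}=-1,0,1$. A walk is standard if $\alpha_i\ge\alpha_l$ for all $i$; it is primitive if $l>0$, $\alpha_0=\alpha_l$ and no $\alpha_i$ with $0<i<l$ equals $\alpha_0$. $G(w)=\sum w(\alpha)z^{l(\alpha)}$ over all standard walks from $0$ to $0$. $M_0=\sum w(\alpha)z^{l(\alpha)}$ over all walks from $0$ to $0$; $M_{-1}$ is the same sum over all walks from $-1$ to $0$; $M_1$ the same sum over all walks from $1$ to $0$; $J_0$ the same sum over all primitive walks from $0$ to $0$. ($M_0$ has constant term $1$, hence is invertible in $\Lambda[[z]]$.) *)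

(* Defs.v *)
From HB Require Import structures.
From mathcomp Require Import all_boot all_order all_algebra all_classical.

Set Implicit Arguments.
Unset Strict Implicit.
Unset Printing Implicit Defensive.

Import Order.TTheory GRing.Theory Num.Theory.

Local Open Scope classical_set_scope.
Local Open Scope ring_scope.

(* [fps R] is R[[z]] for a possibly noncommutative, possibly trivial ring R;
   the indeterminate z is central, so the product is the Cauchy product. *)
Record fps (R : pzRingType) : Type := Fps { fcoef : nat -> R }.

Lemma fpsP (R : pzRingType) (f g : fps R) :
  (forall n, fcoef f n = fcoef g n) -> f = g.
Proof. by case: f g => [f] [g] /= fg; congr Fps; apply/funext. Qed.

HB.instance Definition _ (R : pzRingType) := gen_eqMixin (fps R).
HB.instance Definition _ (R : pzRingType) := gen_choiceMixin (fps R).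

Definition fps_zero (R : pzRingType) : fps R := Fps (fun=> 0).
Definition fps_opp (R : pzRingType) (f : fps R) : fps R :=
  Fps (fun n => - fcoef f n).
Definition fps_add (R : pzRingType) (f g : fps R) : fps R :=
  Fps (fun n => fcoef f n + fcoef g n).
Definition fps_one (R : pzRingType) : fps R := Fps (fun n => (n == 0%N)%:R).
Definition fps_mul (R : pzRingType) (f g : fps R) : fps R :=
  Fps (fun n => \sum_(i < n.+1) fcoef f i * fcoef g (n - i)).

Fact fps_addA (R : pzRingType) : associative (@fps_add R).
Proof. by move=> f g h; apply: fpsP => n /=; rewrite addrA. Qed.
Fact fps_addC (R : pzRingType) : commutative (@fps_add R).
Proof. by move=> f g; apply: fpsP => n /=; rewrite addrC. Qed.
Fact fps_add0 (R : pzRingType) : left_id (@fps_zero R) (@fps_add R).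
Proof. by move=> f; apply: fpsP => n /=; rewrite add0r. Qed.
Fact fps_addN (R : pzRingType) :
  left_inverse (@fps_zero R) (@fps_opp R) (@fps_add R).
Proof. by move=> f; apply: fpsP => n /=; rewrite addNr. Qed.

HB.instance Definition _ (R : pzRingType) :=
  GRing.isZmodule.Build (fps R) (@fps_addA R) (@fps_addC R) (@fps_add0 R)
    (@fps_addN R).

Fact fcoef_mul_rev (R : pzRingType) (f g : fps R) n :
  fcoef (fps_mul f g) n = \sum_(i < n.+1) fcoef f (n - i) * fcoef g i.
Proof.
rewrite /= (reindex_inj rev_ord_inj) /=.
by apply: eq_bigr => j _; rewrite (sub_ordK j).
Qed.

Fact fps_mulA (R : pzRingType) : associative (@fps_mul R).
Proof.
move=> p q r; apply: fpsP => i; rewrite [RHS]fcoef_mul_rev.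
rewrite [LHS](_ : _ =
  \sum_(j < i.+1) fcoef p j * fcoef (fps_mul q r) (i - j)) //.
pose coef3 j k := fcoef p j * (fcoef q (i - j - k)%N * fcoef r k).
transitivity (\sum_(j < i.+1) \sum_(k < i.+1 | (k <= i - j)%N) coef3 j k).
  apply: eq_bigr => j _; rewrite fcoef_mul_rev big_distrr /=.
  by rewrite (big_ord_narrow_leq (leq_subr _ _)).
rewrite (exchange_big_dep predT) //=; apply: eq_bigr => k _.
transitivity (\sum_(j < i.+1 | (j <= i - k)%N) coef3 j k).
  apply: eq_bigl => j; rewrite -ltnS -(ltnS j) -!subSn ?leq_ord //.
  by rewrite -subn_gt0 -(subn_gt0 j) -!subnDA addnC.
rewrite (big_ord_narrow_leq (leq_subr _ _)) big_distrl /=.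
by apply: eq_bigr => j _; rewrite /coef3 -!subnDA addnC mulrA.
Qed.

Fact fps_mul1l (R : pzRingType) : left_id (@fps_one R) (@fps_mul R).
Proof.
move=> f; apply: fpsP => n /=; rewrite big_ord_recl /= subn0 mul1r.
by rewrite big1 ?addr0 // => i _; rewrite mul0r.
Qed.

Fact fps_mul1r (R : pzRingType) : right_id (@fps_one R) (@fps_mul R).
Proof.
move=> f; apply: fpsP => n; rewrite fcoef_mul_rev big_ord_recl /= subn0 mulr1.
by rewrite big1 ?addr0 // => i _; rewrite mulr0.
Qed.

Fact fps_mulDl (R : pzRingType) : left_distributive (@fps_mul R) +%R.
Proof.
move=> f g h; apply: fpsP => n /=; rewrite -big_split /=.
by apply: eq_bigr => i _; rewrite mulrDl.
Qed.

Fact fps_mulDr (R : pzRingType) : right_distributive (@fps_mul R) +%R.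
Proof.
move=> f g h; apply: fpsP => n /=; rewrite -big_split /=.
by apply: eq_bigr => i _; rewrite mulrDr.
Qed.

HB.instance Definition _ (R : pzRingType) :=
  GRing.Zmodule_isPzRing.Build (fps R) (@fps_mulA R) (@fps_mul1l R)
    (@fps_mul1r R) (@fps_mulDl R) (@fps_mulDr R).

Lemma fcoef0 (R : pzRingType) n : fcoef (0 : fps R) n = 0.
Proof. by []. Qed.
Lemma fcoef1 (R : pzRingType) n : fcoef (1 : fps R) n = (n == 0%N)%:R.
Proof. by []. Qed.
Lemma fcoefD (R : pzRingType) (f g : fps R) n :
  fcoef (f + g) n = fcoef f n + fcoef g n.
Proof. by []. Qed.
Lemma fcoefN (R : pzRingType) (f : fps R) n : fcoef (- f) n = - fcoef f n.
Proof. by []. Qed.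
Lemma fcoefM (R : pzRingType) (f g : fps R) n :
  fcoef (f * g) n = \sum_(i < n.+1) fcoef f i * fcoef g (n - i).
Proof. by []. Qed.
Lemma fcoef_sum (R : pzRingType) (I : Type) (r : seq I) (P : pred I)
    (F : I -> fps R) n :
  fcoef (\sum_(i <- r | P i) F i) n = \sum_(i <- r | P i) fcoef (F i) n.
Proof. exact: (big_morph (fun f => fcoef f n) (fun f g => fcoefD f g n)). Qed.

(* z-adic convergence of the series u_0 + u_1 + ... to s: every coefficient of
   the partial sums is eventually equal to that of s. *)
Definition fps_series_cvg (R : pzRingType) (u : nat -> fps R) (s : fps R) :
    Prop :=
  forall n, exists N, forall m, (N <= m)%N ->
    fcoef (\sum_(k < m) u k) n = fcoef s n.

(* The two-sided inverse of f if there is one, and f otherwise. *)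
Definition fps_inv (R : pzRingType) (f : fps R) : fps R :=
  xget f [set g | g * f = 1 /\ f * g = 1].

Lemma fcoefX_lt (R : pzRingType) (f : fps R) k n :
  fcoef f 0 = 0 -> (n < k)%N -> fcoef (f ^+ k) n = 0.
Proof.
move=> f0; elim: k n => // k IHk n; rewrite ltnS => le_nk.
rewrite exprS fcoefM big1 // => -[[|i] lti] _ /=; first by rewrite f0 mul0r.
by rewrite IHk ?mulr0 //; case: n lti le_nk => // n _; rewrite subSS;
  apply: leq_ltn_trans (leq_subr _ _).
Qed.

Lemma fps_left_inv (R : pzRingType) (f : fps R) :
  fcoef f 0 = 1 -> exists2 g, fcoef g 0 = 1 & f * g = 1.
Proof.
move=> f0; pose h := 1 - f.
have h0 : fcoef h 0 = 0 by rewrite fcoefD fcoefN f0 fcoef1 subrr.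
exists (Fps (fun n => fcoef (\sum_(k < n.+1) h ^+ k) n)).
  by rewrite /= big_ord1.
apply: fpsP => n; rewrite fcoefM.
transitivity (fcoef (f * \sum_(k < n.+1) h ^+ k) n).
  rewrite fcoefM; apply: eq_bigr => -[i lti] _ /=; congr (_ * _).
  rewrite !fcoef_sum -!(big_mkord predT (fun k => fcoef (h ^+ k) (n - i))).
  rewrite [RHS](@big_cat_nat _ _ _ (n - i).+1) //= ?ltnS ?leq_subr //.
  rewrite [X in _ = _ + X]big_nat_cond [X in _ = _ + X]big1 ?addr0 // => k.
  by case/andP=> /andP[ltk _] _; exact: fcoefX_lt.
have -> : f = - (h - 1) by rewrite /h addrAC subrr add0r opprK.
rewrite mulNr -subrX1 opprB fcoefD fcoefN.
by rewrite (fcoefX_lt h0) // subr0.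
Qed.

Lemma fps_invP (R : pzRingType) (f : fps R) :
  fcoef f 0 = 1 -> fps_inv f * f = 1 /\ f * fps_inv f = 1.
Proof.
move=> /fps_left_inv[g g0 fg]; have [h _ gh] := fps_left_inv g0.
rewrite /fps_inv; apply: (@xgetPex _ f [set g | g * f = 1 /\ f * g = 1]).
exists g; split=> //; suff -> : f = h by [].
by rewrite -[f]mulr1 -gh mulrA fg mul1r.
Qed.

Definition is_walk (l : nat) (a : l.+1.-tuple int) : Prop :=
  forall i, (i < l)%N -> a`_i.+1 - a`_i \in [:: -1; 0; 1 : int].

Definition from_to (p q : int) (l : nat) (a : l.+1.-tuple int) : Prop :=
  a`_0 = p /\ a`_l = q.

Definition is_standard (l : nat) (a : l.+1.-tuple int) : Prop :=
  forall i, (i <= l)%N -> a`_l <= a`_i.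

Definition is_primitive (l : nat) (a : l.+1.-tuple int) : Prop :=
  [/\ (0 < l)%N, a`_0 = a`_l & forall i, (0 < i < l)%N -> a`_i <> a`_0].

(* Only the values at -1, 0 and 1 matter. *)
Definition step_weight (R : pzRingType) (A B C : R) (d : int) : R :=
  if d == -1 then A else if d == 0 then B else C.

Definition weight (R : pzRingType) (A B C : R) (l : nat)
    (a : l.+1.-tuple int) : R :=
  \prod_(i < l) step_weight A B C (a`_i.+1 - a`_i).

(* The coefficient of z^l is a sum over a set of walks of length l; such a sum
   is meaningful only when this set is finite, see [finite_walks]. *)
Definition walk_gf (R : pzRingType) (A B C : R)
    (P : forall l, l.+1.-tuple int -> Prop) : fps R :=
  Fps (fun l => \sum_(a \in [set a : l.+1.-tuple int | is_walk a /\ P l a])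
                  weight A B C a).

Definition G (R : pzRingType) (A B C : R) : fps R :=
  walk_gf A B C (fun l a => is_standard a /\ from_to 0 0 a).
Definition M0 (R : pzRingType) (A B C : R) : fps R :=
  walk_gf A B C (from_to 0 0).
Definition Mm1 (R : pzRingType) (A B C : R) : fps R :=
  walk_gf A B C (from_to (-1) 0).
Definition M1 (R : pzRingType) (A B C : R) : fps R :=
  walk_gf A B C (from_to 1 0).
Definition J0 (R : pzRingType) (A B C : R) : fps R :=
  walk_gf A B C (fun l a => is_primitive a /\ from_to 0 0 a).

Lemma finite_walks (p : int) (l : nat) :
  finite_set [set a : l.+1.-tuple int | is_walk a /\ a`_0 = p].
Proof.
pose f (s : {ffun 'I_l -> 'I_3}) : l.+1.-tuple int :=
  [tuple p + \sum_(j < l | (j < i)%N) ((s j)%:Z - 1) | i < l.+1].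
apply: (@sub_finite_set _ _ (f @` setT)); last first.
  by apply: finite_image; exact: finite_finset.
move=> a /= [wa a0].
exists [ffun j : 'I_l => inord (absz (a`_j.+1 - a`_j + 1))] => //.
apply/eq_from_tnth => -[i lti]; rewrite tnth_mktuple (tnth_nth 0) /=.
elim: i lti => [|i IHi] lti; first by rewrite big_pred0_eq addr0 a0.
have ltil : (i < l)%N by [].
rewrite (bigD1 (Ordinal ltil)) //= ffunE /=.
rewrite (eq_bigl (fun j : 'I_l => (j < i)%N)); last first.
  by move=> j; rewrite -val_eqE /= ltnS andbC -ltn_neqAle.
rewrite addrCA IHi; last exact: ltnW.
suff -> : ((inord (absz (a`_i.+1 - a`_i + 1)) : 'I_3) : nat)%:Z - 1
  = a`_i.+1 - a`_i by rewrite subrK.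
move: (wa _ ltil); rewrite !inE => /or3P[] /eqP ->; by rewrite inordK.
Qed.

Lemma M0_coef0 (R : pzRingType) (A B C : R) : fcoef (M0 A B C) 0 = 1.
Proof.
rewrite /= (_ : [set a : 1.-tuple int | _] = [set [tuple 0]]).
  by rewrite fsbig_set1 /weight big_ord0.
apply/seteqP; split=> [a [_ [a0 _]] | a ->] /=; last by split.
by case/tupleP: a a0 => x t /= ->; rewrite (tuple0 t); apply/val_inj.
Qed.

(* Main.v *)
(* A walk from p to 0 splits uniquely at its first visit to 0.  With F_p the
   series of the walks from p to 0 that visit 0 only at the end, and M_p that
   of all walks from p to 0, this reads M_p = F_p M_0, and cutting at the first
   return gives M_0 = 1 + J_0 M_0, hence (1).  A walk from 0 to 0 that is not
   standard splits at its first visit to -1, so M_0 - G(w) = F_1 M_{-1}; and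
   F_1 = M_1 M_0^{-1}, hence (2).  Instead of bijections between walks, the
   proofs compare both sides as functions of p: removing the first step of a
   walk gives the same recursion for both, and it has a unique solution. *)
Require Import Defs.
From mathcomp Require Import all_boot all_order all_algebra all_classical.
From mathcomp Require Import zify.

Set Implicit Arguments.
Unset Strict Implicit.
Unset Printing Implicit Defensive.

Import Order.TTheory GRing.Theory Num.Theory.

Local Open Scope ring_scope.

(** * Removing the first step of a walk *)

Lemma is_walk_cons l (p : int) (t : l.+1.-tuple int) :
  is_walk (cons_tuple p t) <-> t`_0 - p \in [:: -1; 0; 1] /\ is_walk t.
Proof.
split=> [w|[w0 w] [|i] ltil]; [| exact: w0 | exact: w].
by split=> [|i ltil]; [exact: (w 0%N) | exact: (w i.+1)].
Qed.

Section StartingPoint.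
Variables (R : pzRingType) (A B C : R).

Lemma weight_cons l (p : int) (t : l.+1.-tuple int) :
  weight A B C (cons_tuple p t) =
  step_weight A B C (t`_0 - p) * weight A B C t.
Proof. by rewrite /weight big_ord_recl. Qed.

Definition gf_from (p : int) (P : forall l, l.+1.-tuple int -> Prop) : fps R :=
  walk_gf A B C (fun l a => a`_0 = p /\ P l a).

(** Effect on series of prepending a step at [p]: the new weight is the leftmost factor, and the
    shift of index is the factor z. *)
Definition step (F : int -> fps R) (p : int) : fps R :=
  Fps (fun l => if l is l'.+1 then
    A * fcoef (F (p - 1)) l' + B * fcoef (F p) l' + C * fcoef (F (p + 1)) l'
  else 0).

Lemma walk_gf_ext (P Q : forall l, l.+1.-tuple int -> Prop) :
  (forall l a, P l a <-> Q l a) -> walk_gf A B C P = walk_gf A B C Q.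
Proof.
move=> PQ; apply: fpsP => l /=; apply: eq_fsbigl.
by apply/seteqP; split=> a [wa /PQ].
Qed.

Lemma gf_from_ext p (P Q : forall l, l.+1.-tuple int -> Prop) :
  (forall l (a : l.+1.-tuple int), a`_0 = p -> P l a <-> Q l a) ->
  gf_from p P = gf_from p Q.
Proof.
by move=> PQ; apply: walk_gf_ext => l a; split=> -[a0 /(PQ _ _ a0)].
Qed.

Lemma gf_from_False p : gf_from p (fun _ _ => False) = 0.
Proof. by apply: fpsP => l; apply: fsbig1 => a [_ []]. Qed.

Lemma step_ext (F F' : int -> fps R) p : F =1 F' -> step F p = step F' p.
Proof. by move=> FF'; apply: fpsP => -[|l] //=; rewrite !FF'. Qed.

Lemma step0 p : step (fun=> 0) p = 0.
Proof. by apply: fpsP => -[|l] //=; rewrite !mulr0 !addr0. Qed.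

Lemma stepB F F' p : step (fun q => F q - F' q) p = step F p - step F' p.
Proof.
apply: fpsP => -[|l]; rewrite fcoefD fcoefN /=; first by rewrite subr0.
by rewrite !mulrDr !mulrN !opprD [RHS]addrACA [X in _ = X + _]addrACA.
Qed.

(** Step weights act on the left only, so right multiplication by a fixed series preserves the
    recursion. *)
Lemma stepM F g p : step F p * g = step (fun q => F q * g) p.
Proof.
apply: fpsP => -[|l]; first by rewrite fcoefM big_ord1 /= mul0r.
rewrite fcoefM big_ord_recl /= mul0r add0r !mulr_sumr -!big_split /=.
by apply: eq_bigr => i _; rewrite /bump /= add1n subSS !mulrDl !mulrA.
Qed.

(** With the first increment [d] fixed, prepending [p] is a bijection from the walks starting at
    [p + d]. *)
Lemma weight_sum_cons l (p d : int) (P : l.+1.-tuple int -> Prop)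
    (P' : l.+2.-tuple int -> Prop) :
  d \in [:: -1; 0; 1] -> (forall t, P' (cons_tuple p t) <-> P t) ->
  \sum_(a \in ([set a | is_walk a /\ a`_0 = p /\ a`_1 = p + d /\ P' a])%classic)
     weight A B C a =
  step_weight A B C d *
    \sum_(t \in ([set t | is_walk t /\ t`_0 = p + d /\ P t])%classic)
      weight A B C t.
Proof.
move=> d1 PP'; set S := [set t | is_walk t /\ t`_0 = p + d /\ P t]%classic.
have finS : finite_set S.
  by apply: (sub_finite_set _ (finite_walks (p + d) l)) => t [wt [t0 _]].
rewrite fsbig_distrr //; rewrite (_ : mkset _ = (cons_tuple p @` S)%classic).
  rewrite fsbig_image; last first.
    by move=> s t _ _ /(congr1 val) [] /val_inj.
  apply: eq_fsbigr => t; rewrite inE => -[_ [t0 _]].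
  by rewrite weight_cons t0 addrC addKr.
apply/seteqP; split=> [a|_ [t [wt [t0 Pt]] <-]].
  case/tupleP: a => x t /= [/is_walk_cons[w0 wt] [xp [t0 Pt]]].
  by rewrite {}xp in w0 Pt *; exists t => //; split=> //; split=> //; apply/PP'.
split; first by apply/is_walk_cons; rewrite t0 addrC addKr.
by split=> //; split=> //; apply/PP'.
Qed.

(** [b] accounts for the walk of length 0, and [Q] is what [P] demands of the tail; longer walks
    form three disjoint classes according to the first increment. *)
Lemma gf_from_step p (b : bool) (P Q : forall l, l.+1.-tuple int -> Prop) :
  (P 0%N [tuple p] <-> b) ->
  (forall l (t : l.+1.-tuple int), P l.+1 (cons_tuple p t) <-> Q l t) ->
  gf_from p P = b%:R + step (gf_from^~ Q) p.
Proof.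
have single (a : 1.-tuple int) : a`_0 = p -> a = [tuple p].
  by case/tupleP: a => x t /= ->; rewrite (tuple0 t); apply/val_inj.
move=> P0 PS; apply: fpsP => -[|l]; rewrite fcoefD /=.
  rewrite addr0; case: b P0 => P0 /=.
    rewrite (_ : mkset _ = [set [tuple p]]%classic).
      by rewrite fsbig_set1 /weight big_ord0.
    apply/seteqP; split=> [a [_ [a0 _]]|_ ->] /=; last first.
      by do ?split => //; apply/P0.
    exact: single.
  by apply: fsbig1 => a [_ [/single -> /P0]].
have -> : fcoef (b%:R : fps R) l.+1 = 0 by case: b {P0}.
rewrite add0r; set S := mkset _.
set S_ := fun d : int => [set a : l.+2.-tuple int |
  is_walk a /\ a`_0 = p /\ a`_1 = p + d /\ P l.+1 a]%classic.
have finS d : finite_set (S_ d).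
  by apply: (sub_finite_set _ (finite_walks p l.+1)) => t [wt [t0 _]].
have sumS d (d1 : d \in [:: -1; 0; 1]) := @weight_sum_cons l p d _ _ d1 (PS l).
have -> : S = (S_ (-1)%R `|` (S_ 0%R `|` S_ 1%R))%classic.
  apply/seteqP; split=> a; last by rewrite /S /S_ /=; tauto.
  move=> [wa [a0 Pa]]; have := wa 0%N isT.
  have: a`_1 = p + (a`_1 - p) by rewrite addrC subrK.
  by rewrite a0 !inE => a1 /or3P[] /eqP d1; rewrite d1 in a1;
    [left | right; left | right; right].
rewrite !fsbigU0 ?finite_setU //; first by rewrite !sumS //= addr0 addrA.
- by move=> a [[_ [_ [aE _]]] [_ [_ []]]]; rewrite aE => /addrI.
- by move=> a [[_ [_ [aE _]]] [] [_ [_ []]]]; rewrite aE => /addrI.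
Qed.

(** * Recursions for the individual series *)

Definition ends_at0 l (a : l.+1.-tuple int) : Prop := a`_l = 0.

Definition first_hits0 l (a : l.+1.-tuple int) : Prop :=
  a`_l = 0 /\ forall i, (i < l)%N -> a`_i <> 0.

Lemma gf_ends_at0 p :
  gf_from p ends_at0 = (p == 0)%:R + step (gf_from^~ ends_at0) p.
Proof. by apply: gf_from_step => //; split=> /eqP. Qed.

Lemma gf_first_hits0 p : p != 0 ->
  gf_from p first_hits0 = step (gf_from^~ first_hits0) p.
Proof.
move=> p0; rewrite (@gf_from_step _ false _ first_hits0) ?add0r //.
  by split=> // -[/eqP]; rewrite (negPf p0).
move=> l t; split=> -[tl tn0]; split=> //; first by move=> i; exact: (tn0 i.+1).
by case=> [|i]; [move=> _; exact/eqP | exact: tn0].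
Qed.

Lemma gf_first_hits0_0 : gf_from 0 first_hits0 = 1.
Proof.
(* A longer walk from 0 already visits 0 at index 0, so no tail is admissible. *)
rewrite (@gf_from_step _ true _ (fun _ _ => False)).
- by rewrite (step_ext _ gf_from_False) step0 addr0.
- by split.
- by move=> l t; split=> // -[_ /(_ 0%N isT)].
Qed.

(** A start at height [p >= 0] is never below the final height 0, so the condition passes unchanged
    to the tail. *)
Lemma gf_standard p : 0 <= p ->
  gf_from p (fun l a => is_standard a /\ ends_at0 a) =
  (p == 0)%:R + step (gf_from^~ (fun l a => is_standard a /\ ends_at0 a)) p.
Proof.
move=> p0; apply: gf_from_step => [|l t].
  by split=> [[_ /eqP] //|/eqP p0']; split=> // -[].
split=> -[st tl]; split=> //; first by move=> i; exact: (st i.+1).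
by case=> [|i] ltil; [rewrite /= tl | exact: st].
Qed.

Lemma gf_standard_lt0 p : p < 0 ->
  gf_from p (fun l a => is_standard a /\ ends_at0 a) = 0.
Proof.
move=> p0; rewrite -(gf_from_False p); apply: gf_from_ext => l a a0.
split=> // -[/(_ 0%N isT) + tl].
by rewrite a0 tl leNgt p0.
Qed.

(** A primitive walk without its first step is a walk that visits 0 only at its end. *)
Lemma J0_step : J0 A B C = step (gf_from^~ first_hits0) 0.
Proof.
transitivity (gf_from 0 (fun l a =>
  [/\ (0 < l)%N, a`_l = 0 & forall i, (0 < i < l)%N -> a`_i <> 0])).
  apply: walk_gf_ext => l a; split=> [[[l0 aE an0] [a0 al]]|[a0 [l0 al an0]]].
    by split=> //; split=> // i /an0; rewrite a0.
  by do !split=> //; rewrite a0 ?al.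
rewrite (@gf_from_step _ false _ first_hits0) ?add0r //; first by split=> // -[].
move=> l t; split=> [[_ tl tn0]|[tl tn0]].
  by split=> // i ltil; exact: (tn0 i.+1).
by split=> // -[|i] //=; exact: tn0.
Qed.

(** * Comparison of series by uniqueness *)

Lemma step_unique (S : int -> Prop) (F : int -> fps R) :
  (forall p, S p -> F p = 0 \/ [/\ F p = step F p, S (p - 1) & S (p + 1)]) ->
  forall p, S p -> F p = 0.
Proof.
(* [step F p] has no constant term, and its coefficient [l.+1] involves only coefficients [l] of [F]
   at neighbours of [p], which stay in [S]; points where [F] vanishes act as boundary. *)
move=> FS p Sp; apply: fpsP => l; elim: l p Sp => [|l IHl] p Sp;
  have [->//|[-> Sm1 S1]] := FS p Sp => //=.
by rewrite !IHl // !mulr0 !addr0.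
Qed.

Lemma gf_ends_at0_first_hit p :
  gf_from p ends_at0 = gf_from p first_hits0 * M0 A B C.
Proof.
apply/eqP; rewrite -subr_eq0; apply/eqP.
pose F q := gf_from q ends_at0 - gf_from q first_hits0 * M0 A B C.
apply: (@step_unique (fun=> True) F) => // q _.
(* The boundary is 0; elsewhere both terms satisfy the recursion without constant term. *)
have [->|q0] := eqVneq q 0.
  by left; rewrite /F gf_first_hits0_0 mul1r subrr.
right; split=> //; rewrite stepB -stepM -gf_first_hits0 //.
by rewrite {1}/F gf_ends_at0 (negPf q0) add0r.
Qed.

(* By translation, [gf_from (p + 1) first_hits0] is the series of the first
   passages from p to -1. *)
Lemma gf_ends_at0_standard p : -1 <= p ->
  gf_from p ends_at0 - gf_from p (fun l a => is_standard a /\ ends_at0 a) =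
  gf_from (p + 1) first_hits0 * Mm1 A B C.
Proof.
move=> p1; apply/eqP; rewrite -subr_eq0; apply/eqP.
pose F q := gf_from q ends_at0
  - gf_from q (fun l a => is_standard a /\ ends_at0 a)
  - gf_from (q + 1) first_hits0 * Mm1 A B C.
apply: (@step_unique (fun q => -1 <= q) F) p1 => q q1.
(* The boundary is -1, where no walk to 0 is standard and the first passage is trivial. *)
have [->|q1'] := eqVneq q (-1).
  left; rewrite /F gf_standard_lt0 // addNr gf_first_hits0_0.
  by rewrite mul1r subr0 subrr.
right; split; [|lia|lia].
rewrite /F !stepB -(stepM (fun q => gf_from (q + 1) first_hits0)).
have -> : step (fun q => gf_from (q + 1) first_hits0) q =
    step (gf_from^~ first_hits0) (q + 1).
  by apply: fpsP => -[|l] //=; rewrite (addrAC q).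
rewrite -gf_first_hits0; last by lia.
(* The constants [(q == 0)%:R] of the two recursions cancel. *)
rewrite {1}gf_ends_at0 {1}gf_standard; last by lia.
by rewrite opprD addrACA subrr add0r.
Qed.

Lemma M0_renewal : M0 A B C = 1 + J0 A B C * M0 A B C.
Proof.
rewrite J0_step stepM {1}(gf_ends_at0 0 : M0 A B C = _) eqxx.
by congr (_ + _); apply: step_ext => q; exact: gf_ends_at0_first_hit.
Qed.

End StartingPoint.

(** * Geometric series and conclusion *)

Lemma fps_series_cvg_geometric (R : pzRingType) (f g : fps R) :
  fcoef f 0 = 0 -> g = 1 + f * g -> fps_series_cvg (fun k => f ^+ k) g.
Proof.
move=> f0 gE n; exists n.+1 => m ltnm.
(* Substituting the equation into itself [m] times leaves a remainder of order at least [m], hence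
   beyond [n]. *)
have -> : g = \sum_(k < m) f ^+ k + f ^+ m * g.
  elim: m {ltnm} => [|m IHm]; first by rewrite big_ord0 add0r mul1r.
  by rewrite {1}IHm {1}gE mulrDr mulr1 big_ord_recr /= addrA mulrA -exprSr.
rewrite fcoefD fcoefM [X in _ = _ + X]big1 ?addr0 // => i _.
by rewrite fcoefX_lt ?mul0r //; apply: leq_trans ltnm; exact: ltn_ord.
Qed.

Theorem theorem3p5 (R : pzRingType) (A B C : R) :
  fps_series_cvg (fun k => J0 A B C ^+ k) (M0 A B C) /\
  G A B C = M0 A B C - M1 A B C * fps_inv (M0 A B C) * Mm1 A B C.
Proof.
split.
  by apply: fps_series_cvg_geometric (M0_renewal A B C); rewrite J0_step.
have [_ M0V] := fps_invP (M0_coef0 A B C).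
have -> : M1 A B C = gf_from A B C 1 first_hits0 * M0 A B C.
  exact: gf_ends_at0_first_hit.
have GE : G A B C = gf_from A B C 0 (fun l a => is_standard a /\ ends_at0 a).
  by apply: walk_gf_ext => l a; split=> -[? []].
rewrite -(mulrA _ (M0 _ _ _)) M0V mulr1.
have /(_ isT) := @gf_ends_at0_standard R A B C 0.
by rewrite add0r -GE => <-; rewrite opprB addrC subrK.
Qed.
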